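(* An element of $\mathrm{PSL}(3,\mathbb{H})$ is reversible in $\mathrm{PSL}(3,\mathbb{H})$ if and only if it is strongly reversible in $\mathrm{PSL}(3,\mathbb{H})$.
   Context: $\mathbb{H}$ denotes Hamilton's real quaternions. For $A\in \mathrm{M}(3,\mathbb{H})$ write $A=A_1+A_2\mathbf{j}$ with $A_1,A_2\in \mathrm{M}(3,\mathbb{C})$, and let $\Phi(A)=\begin{pmatrix} A_1 & A_2\\ -\overline{A_2} & \overline{A_1}\end{pmatrix}\in \mathrm{M}(6,\mathbb{C})$ be its complex adjoint. Put $\det_{\mathbb{H}}(A):=\det(\Phi(A))$ and $\mathrm{SL}(3,\mathbb{H})=\{g\in \mathrm{M}(3,\mathbb{H}) : \det_{\mathbb{H}}(g)=1\}$. Put $\mathrm{PSL}(3,\mathbb{H})=\mathrm{SL}(3,\mathbb{H})/\{\pm \mathrm{I}_3\}$. An element $g$ of a group $G$ is called reversible in $G$ if it is conjugate to $g^{-1}$ in $G$. It is called strongly reversible in $G$ if there is $h\in G$ with $h^2=1$ (order at most $2$) and $hgh^{-1}=g^{-1}$; equivalently, $g$ is a product of at most two involutions of $G$. *)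

(* Defs.v *)
From HB Require Import structures.
From mathcomp Require Import all_boot all_order all_algebra.
From mathcomp Require Import ring.
From mathcomp Require Import complex.

Set Implicit Arguments.
Unset Strict Implicit.
Unset Printing Implicit Defensive.

Import Order.TTheory GRing.Theory Num.Theory.
Local Open Scope ring_scope.
Local Open Scope complex_scope.
Local Open Scope quotient_scope.

(* [Quat a b] stands for a + b j with a, b complex; the product below is
   forced by j ^ 2 = -1 and j z = z^* j for z complex.  The lemmas [quatE] and
   [hamilton] relate this to the usual basis 1, i, j, k over the reals. *)
Record quat (R : rcfType) := Quat { qfst : R[i]; qsnd : R[i] }.

Section Quaternion.
Variable R : rcfType.
Local Notation H := (quat R).
Implicit Types x y z : H.

Definition quat_pair x : R[i] * R[i] := (qfst x, qsnd x).
Definition pair_quat (p : R[i] * R[i]) : H := Quat p.1 p.2.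

Lemma quat_pairK : cancel quat_pair pair_quat.
Proof. by case. Qed.

HB.instance Definition _ := Choice.copy H (can_type quat_pairK).

Definition quat_add x y : H := Quat (qfst x + qfst y) (qsnd x + qsnd y).
Definition quat_opp x : H := Quat (- qfst x) (- qsnd x).
Definition quat_mul x y : H :=
  Quat (qfst x * qfst y - qsnd x * conjc (qsnd y))
       (qfst x * qsnd y + qsnd x * conjc (qfst y)).

Lemma quat_addqA : associative quat_add.
Proof. by move=> [a b] [c d] [e f]; rewrite /quat_add /= !addrA. Qed.
Lemma quat_addqC : commutative quat_add.
Proof. by move=> [a b] [c d]; rewrite /quat_add /= addrC [b + d]addrC. Qed.
Lemma quat_add0q : left_id (Quat 0 0) quat_add.
Proof. by move=> [a b]; rewrite /quat_add /= !add0r. Qed.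
Lemma quat_addNq : left_inverse (Quat 0 0) quat_opp quat_add.
Proof. by move=> [a b]; rewrite /quat_add /= !addNr. Qed.

HB.instance Definition _ := GRing.isZmodule.Build H quat_addqA quat_addqC quat_add0q quat_addNq.

Lemma quat_mulqE (a b c d : R[i]) :
  quat_mul (Quat a b) (Quat c d) = Quat (a * c - b * conjc d) (a * d + b * conjc c).
Proof. by []. Qed.

Lemma quat_mulqA : associative quat_mul.
Proof.
move=> [a b] [c d] [e f]; rewrite /quat_mul /= !(rmorphB, rmorphD, rmorphM) /=.
rewrite !conjcK; congr Quat; ring.
Qed.
Lemma quat_mul1q : left_id (Quat 1 0) quat_mul.
Proof. by move=> [a b]; rewrite /quat_mul /=; congr Quat; ring. Qed.
Lemma quat_mulq1 : right_id (Quat 1 0) quat_mul.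
Proof.
by move=> [a b]; rewrite quat_mulqE conjc1 conjc0; congr Quat; ring.
Qed.
Lemma quat_mulqDl : left_distributive quat_mul +%R.
Proof. by move=> [a b] [c d] [e f]; rewrite /quat_mul /=; congr Quat => /=; ring. Qed.
Lemma quat_mulqDr : right_distributive quat_mul +%R.
Proof.
move=> [a b] [c d] [e f]; rewrite /quat_mul /= !rmorphD /=.
by congr Quat => /=; ring.
Qed.
Lemma quat_oneq_neq0 : Quat 1 0 != 0 :> H.
Proof. by apply/eqP => -[] /eqP; rewrite oner_eq0. Qed.

HB.instance Definition _ := GRing.Zmodule_isNzRing.Build H
  quat_mulqA quat_mul1q quat_mulq1 quat_mulqDl quat_mulqDr quat_oneq_neq0.

Definition quat_real (a : R) : H := Quat a%:C 0.
Definition quat_i : H := Quat 'i 0.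
Definition quat_j : H := Quat 0 1.
Definition quat_k : H := Quat 0 'i.

Lemma quatE (a b c d : R) :
  Quat (a +i* b) (c +i* d) =
  quat_real a + quat_real b * quat_i + quat_real c * quat_j
  + quat_real d * quat_k.
Proof.
congr Quat; rewrite /= ?rmorph0 ?rmorph1; apply/eqP; rewrite eq_complex /=;
  by apply/andP; split; apply/eqP; ring.
Qed.

Lemma quat_realC (a : R) x : quat_real a * x = x * quat_real a.
Proof.
case: x => [[x1 x2] [x3 x4]]; congr Quat; rewrite /= ?rmorph0;
  by apply/eqP; rewrite eq_complex /=; apply/andP; split; apply/eqP; ring.
Qed.

Lemma hamilton :
  [/\ quat_i * quat_i = -1, quat_j * quat_j = -1, quat_k * quat_k = -1
    & quat_i * quat_j * quat_k = -1].
Proof.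
by split; congr Quat; apply/eqP; rewrite eq_complex /=;
  apply/andP; split; apply/eqP; ring.
Qed.

Lemma qfst_is_additive : zmod_morphism (@qfst R). Proof. by []. Qed.
Lemma qsnd_is_additive : zmod_morphism (@qsnd R). Proof. by []. Qed.
HB.instance Definition _ :=
  GRing.isZmodMorphism.Build H R[i] (@qfst R) qfst_is_additive.
HB.instance Definition _ :=
  GRing.isZmodMorphism.Build H R[i] (@qsnd R) qsnd_is_additive.

End Quaternion.

Section ComplexAdjoint.
Variables (R : rcfType) (n : nat).
Implicit Types A B : 'M[quat R]_n.

Definition cpart1 A : 'M[R[i]]_n := map_mx (@qfst R) A.
Definition cpart2 A : 'M[R[i]]_n := map_mx (@qsnd R) A.

Definition Phi A : 'M[R[i]]_(n + n) :=
  block_mx (cpart1 A) (cpart2 A)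
           (- map_mx conjc (cpart2 A)) (map_mx conjc (cpart1 A)).

Definition detH A : R[i] := \det (Phi A).

Definition ofPhi (X : 'M[R[i]]_(n + n)) : 'M[quat R]_n :=
  \matrix_(i, j) Quat (ulsubmx X i j) (ursubmx X i j).

Lemma cpart1_ofPhi X : cpart1 (ofPhi X) = ulsubmx X.
Proof. by apply/matrixP => i j; rewrite [LHS]mxE [in LHS]mxE. Qed.

Lemma cpart2_ofPhi X : cpart2 (ofPhi X) = ursubmx X.
Proof. by apply/matrixP => i j; rewrite [LHS]mxE [in LHS]mxE. Qed.

Lemma PhiK : cancel Phi ofPhi.
Proof.
move=> A; apply/matrixP => i j.
by rewrite mxE block_mxKul block_mxKur !mxE; case: (A i j).
Qed.

Lemma Phi_inj : injective Phi. Proof. exact: can_inj PhiK. Qed.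

Lemma PhiM A B : Phi (A *m B) = Phi A *m Phi B.
Proof.
have e1 : cpart1 (A *m B) =
    cpart1 A *m cpart1 B - cpart2 A *m map_mx conjc (cpart2 B).
  apply/matrixP => i j; rewrite !mxE raddf_sum -sumrB /=.
  by apply: eq_bigr => k _; rewrite !mxE.
have e2 : cpart2 (A *m B) =
    cpart1 A *m cpart2 B + cpart2 A *m map_mx conjc (cpart1 B).
  apply/matrixP => i j; rewrite !mxE raddf_sum -big_split /=.
  by apply: eq_bigr => k _; rewrite !mxE.
have cK (M : 'M[R[i]]_n) : map_mx conjc (map_mx conjc M) = M.
  by apply/matrixP => i j; rewrite !mxE conjcK.
rewrite /Phi mulmx_block e1 e2 !(map_mxD, map_mxN, map_mxM) /= !cK.
rewrite !mulmxN !mulNmx; congr block_mx; last exact: addrC.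
by rewrite opprD; exact: addrC.
Qed.

Lemma Phi1 : Phi 1%:M = 1%:M.
Proof.
rewrite [RHS]scalar_mx_block /Phi; congr block_mx; apply/matrixP => i j;
  by rewrite !mxE; case: (i == j); rewrite ?rmorph0 ?rmorph1 ?oppr0.
Qed.

Lemma PhiN A : Phi (- A) = - Phi A.
Proof. by rewrite opp_block_mx /Phi /cpart1 /cpart2 !map_mxN. Qed.

Lemma detHM A B : detH (A *m B) = detH A * detH B.
Proof. by rewrite /detH PhiM det_mulmx. Qed.

Lemma detH1 : detH 1%:M = 1.
Proof. by rewrite /detH Phi1 det1. Qed.

Lemma detHN A : detH (- A) = detH A.
Proof.
rewrite /detH PhiN -scaleN1r detZ; have -> : (-1) ^+ (n + n) = 1 :> R[i].
  by rewrite exprD -exprMn mulrNN mulr1 expr1n.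
by rewrite mul1r.
Qed.

(* The image of [Phi] is the set of X with X J = J X^*, which is stable under
   inversion. *)
Lemma Phi_ofPhi_inv A : detH A = 1 -> Phi (ofPhi (invmx (Phi A))) = invmx (Phi A).
Proof.
move=> dA; have uA : Phi A \in unitmx by rewrite unitmxE -/(detH A) dA unitr1.
pose J : 'M[R[i]]_(n + n) := block_mx 0 1%:M (- 1%:M) 0.
have JA : Phi A *m J = J *m map_mx conjc (Phi A).
  rewrite /Phi /J map_block_mx !mulmx_block !(mulmx0, mul0mx, mulmx1, mul1mx).
  rewrite !(mulmxN, mulNmx, mulmx1, mul1mx, add0r, addr0, map_mxN) /= ?opprK.
  by congr block_mx; apply/matrixP => i j; rewrite !mxE ?conjcK.
have uC : map_mx conjc (Phi A) \in unitmx.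
  by rewrite unitmxE det_map_mx -/(detH A) dA rmorph1 unitr1.
set X := invmx (Phi A).
have JX : X *m J = J *m map_mx conjc X.
  rewrite /X map_invmx -[LHS](mulmxK uC) -[X in X *m invmx _]mulmxA -JA.
  by rewrite mulKmx.
move: JX; rewrite -[X]submxK; move: (ulsubmx X) (ursubmx X) (dlsubmx X) (drsubmx X).
move=> a b c d; rewrite /J map_block_mx !mulmx_block.
rewrite !(mulmx0, mul0mx, mulmx1, mul1mx, mulmxN, mulNmx, add0r, addr0) /=.
case/eq_block_mx => _ _ /oppr_inj -> ->.
by rewrite /Phi cpart1_ofPhi cpart2_ofPhi block_mxKul block_mxKur.
Qed.

End ComplexAdjoint.

Record SL (n : nat) (R : rcfType) :=
  MkSL { slval :> 'M[quat R]_n; slvalP : detH slval == 1 }.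

HB.instance Definition _ n R := [isSub for @slval n R].
HB.instance Definition _ n R := [Choice of SL n R by <:].

Section SLGroup.
Variables (n : nat) (R : rcfType).
Implicit Types x y : SL n R.

Fact oneSL_subproof : @detH R n 1%:M == 1.
Proof. by rewrite detH1. Qed.
Definition oneSL : SL n R := MkSL oneSL_subproof.

Fact mulSL_subproof x y : detH (slval x *m slval y) == 1.
Proof. by rewrite detHM (eqP (slvalP x)) (eqP (slvalP y)) mulr1. Qed.
Definition mulSL x y : SL n R := MkSL (mulSL_subproof x y).

Fact invSL_subproof x : detH (ofPhi (invmx (Phi (slval x)))) == 1.
Proof.
have dx := eqP (slvalP x).
by rewrite /detH Phi_ofPhi_inv // det_inv -/(detH _) dx invr1.
Qed.
Definition invSL x : SL n R := MkSL (invSL_subproof x).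

Fact mulSLA : associative mulSL.
Proof. by move=> x y z; apply: val_inj; rewrite /= mulmxA. Qed.
Fact mul1SL : left_id oneSL mulSL.
Proof. by move=> x; apply: val_inj; rewrite /= mul1mx. Qed.
Fact mulSL1 : right_id oneSL mulSL.
Proof. by move=> x; apply: val_inj; rewrite /= mulmx1. Qed.
Fact SL_unit x : Phi (slval x) \in unitmx.
Proof. by rewrite unitmxE -/(detH _) (eqP (slvalP x)) unitr1. Qed.
Fact mulVSL : left_inverse oneSL invSL mulSL.
Proof.
move=> x; apply: val_inj; apply: Phi_inj.
by rewrite /= PhiM Phi_ofPhi_inv ?(eqP (slvalP x)) // mulVmx ?SL_unit // Phi1.
Qed.
Fact mulSLV : right_inverse oneSL invSL mulSL.
Proof.
move=> x; apply: val_inj; apply: Phi_inj.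
by rewrite /= PhiM Phi_ofPhi_inv ?(eqP (slvalP x)) // mulmxV ?SL_unit // Phi1.
Qed.

HB.instance Definition _ :=
  isGroup.Build (SL n R) mulSLA mul1SL mulSL1 mulVSL mulSLV.

Fact negSL_subproof x : detH (- slval x) == 1.
Proof. by rewrite detHN slvalP. Qed.
Definition negSL x : SL n R := MkSL (negSL_subproof x).

(* x and y lie in the same coset of {I, -I}. *)
Definition eqPSL x y : bool := (x == y) || (x == negSL y).

Fact negSLK : involutive negSL.
Proof. by move=> x; apply: val_inj; rewrite /= opprK. Qed.
Fact negSLMl x y : mulSL (negSL x) y = negSL (mulSL x y).
Proof. by apply: val_inj; rewrite /= mulNmx. Qed.
Fact negSLMr x y : mulSL x (negSL y) = negSL (mulSL x y).
Proof. by apply: val_inj; rewrite /= mulmxN. Qed.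

Fact eqPSL_refl : reflexive eqPSL.
Proof. by move=> x; rewrite /eqPSL eqxx. Qed.
Fact eqPSL_sym : symmetric eqPSL.
Proof.
by move=> x y; rewrite /eqPSL eq_sym [x == _]eq_sym (can2_eq negSLK negSLK).
Qed.
Fact eqPSL_trans : transitive eqPSL.
Proof.
move=> y x z; rewrite /eqPSL => /orP[]/eqP-> // /orP[]/eqP->.
  by rewrite eqxx orbT.
by rewrite negSLK eqxx.
Qed.

Canonical eqPSL_equiv := EquivRel eqPSL eqPSL_refl eqPSL_sym eqPSL_trans.

Definition PSL := {eq_quot eqPSL}.
HB.instance Definition _ := Choice.on PSL.
HB.instance Definition _ := EqQuotient.on PSL.

Definition onePSL : PSL := \pi_PSL oneSL.
Definition mulPSL (u v : PSL) : PSL := \pi_PSL (mulSL (repr u) (repr v)).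
Definition invPSL (u : PSL) : PSL := \pi_PSL (invSL (repr u)).

Fact pi_mulPSL x y : mulPSL (\pi_PSL x) (\pi_PSL y) = \pi_PSL (mulSL x y).
Proof.
apply/eqmodP; case: piP => x' /eqmodP /= ex; case: piP => y' /eqmodP /= ey.
move: ex ey; rewrite /eqPSL => /orP[]/eqP-> /orP[]/eqP->;
  by rewrite ?negSLMl ?negSLMr ?negSLMl ?negSLK ?eqxx ?orbT.
Qed.

Fact pi_invPSL x : invPSL (\pi_PSL x) = \pi_PSL (invSL x).
Proof.
apply/eqmodP; case: piP => y /eqmodP /=; rewrite /eqPSL => /orP[]/eqP->.
  by rewrite eqxx.
apply/orP; right; apply/eqP.
rewrite -[LHS]mulSL1 -(mulVSL (negSL y)).
by rewrite mulVSL mulSL1 -[RHS]mul1SL -(mulVSL y) -mulSLA negSLMr -negSLMl mulSLV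
  mulSL1.
Qed.

Fact mulPSLA : associative mulPSL.
Proof.
elim/quotW=> x; elim/quotW=> y; elim/quotW=> z.
rewrite (pi_mulPSL y z) (pi_mulPSL x y) (pi_mulPSL x) (pi_mulPSL _ z).
by rewrite mulSLA.
Qed.
Fact mul1PSL : left_id onePSL mulPSL.
Proof. by elim/quotW=> x; rewrite pi_mulPSL mul1SL. Qed.
Fact mulPSL1 : right_id onePSL mulPSL.
Proof. by elim/quotW=> x; rewrite pi_mulPSL mulSL1. Qed.
Fact mulVPSL : left_inverse onePSL invPSL mulPSL.
Proof. by elim/quotW=> x; rewrite pi_invPSL pi_mulPSL mulVSL. Qed.
Fact mulPSLV : right_inverse onePSL invPSL mulPSL.
Proof. by elim/quotW=> x; rewrite pi_invPSL pi_mulPSL mulSLV. Qed.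

HB.instance Definition _ :=
  isGroup.Build PSL mulPSLA mul1PSL mulPSL1 mulVPSL mulPSLV.

End SLGroup.

Definition reversible (G : groupType) (g : G) : Prop :=
  exists h : G, (h * g * h^-1 = g^-1)%g.

Definition strongly_reversible (G : groupType) (g : G) : Prop :=
  exists2 h : G, (h ^+ 2 = 1)%g & (h * g * h^-1 = g^-1)%g.

(* Main.v *)
Require Import Defs.
From HB Require Import structures.
From mathcomp Require Import all_boot all_order all_algebra perm.
From mathcomp Require Import complex reals ring.

(* Every g in M(3, H) is similar to a complex Jordan matrix M whose eigenvalues
   have nonnegative imaginary part, and h g h^-1 = +- g^-1 is equivalent to
   g h g = +- h.

   If all eigenvalues are unimodular, g is reversed by some h with h^2 = -1,
   whatever the hypothesis: normalising the off-diagonal entries of M to the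
   eigenvalues, there is a real D with D^2 = 1 and M^* D M = D (entrywise
   conjugation), and h = j D works because j M = M^* j.

   Otherwise, since h sends eigenvectors of g to eigenvectors, the spectrum is
   stable under p |-> 1 / p^* (resp. p |-> - 1 / p).  An eigenvalue p with
   |p| <> 1 is thus paired with a distinct one, and det g = 1 forces the third
   one to be unimodular, hence paired with itself.  So M is diagonal with
   distinct entries, and with D the transposition matrix exchanging the pair,
   h = j D (h^2 = -1) or h = D (h^2 = 1) reverses g. *)

Set Implicit Arguments.
Unset Strict Implicit.
Unset Printing Implicit Defensive.

Import Order.TTheory GRing.Theory Num.Theory.
Local Open Scope ring_scope.
Local Open Scope complex_scope.
Local Open Scope quotient_scope.

(* Inside a ring operation [x ^*] would otherwise be parsed as [Num.conj x]. *)
Local Notation "x ^*" := (conjc x) : ring_scope.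
Local Arguments conjc : simpl never.

(** * Quaternions *)

Section QuaternionInverse.
Variable R : rcfType.
Local Notation C := R[i].
Local Notation H := (quat R).
Implicit Types (a b c : C) (x y z : H).

Lemma quat_eq x y : qfst x = qfst y -> qsnd x = qsnd y -> x = y.
Proof. by case: x y => [? ?] [? ?] /= -> ->. Qed.

Lemma qfstM x y : qfst (x * y) = qfst x * qfst y - qsnd x * (qsnd y)^*.
Proof. by []. Qed.

Lemma qsndM x y : qsnd (x * y) = qfst x * qsnd y + qsnd x * (qfst y)^*.
Proof. by []. Qed.

Definition sqnormq x : C := qfst x * (qfst x)^* + qsnd x * (qsnd x)^*.

Lemma sqnormq_eq0 x : (sqnormq x == 0) = (x == 0).
Proof.
rewrite /sqnormq paddr_eq0 ?mulcJ_ge0 // !mulf_eq0 !conjc_eq0 !orbb.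
apply/andP/eqP => [[/eqP xa /eqP xb]|->]; first exact: quat_eq.
by rewrite !raddf0 eqxx.
Qed.

(** The value at 0 is 0, because the inverse of a unit ring has to fix the non-units. *)
Definition quat_inv x : H :=
  if x == 0 then x
  else Quat ((qfst x)^* / sqnormq x) (- qsnd x / sqnormq x).

Lemma sqnormq_conj x : (sqnormq x)^* = sqnormq x.
Proof. by rewrite /sqnormq rmorphD !rmorphM /= !conjcK; ring. Qed.

Fact quat_mulVq : {in [pred x : H | x != 0], left_inverse 1 quat_inv *%R}.
Proof.
move=> x; rewrite inE /quat_inv => x0; rewrite (negPf x0).
have N0 : sqnormq x != 0 by rewrite sqnormq_eq0.
apply: quat_eq; rewrite ?qfstM ?qsndM /=; last by field.
by apply: (mulIf N0); rewrite mul1r [RHS]/sqnormq; field.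
Qed.

Fact quat_mulqV : {in [pred x : H | x != 0], right_inverse 1 quat_inv *%R}.
Proof.
move=> x; rewrite inE /quat_inv => x0; rewrite (negPf x0).
have N0 : sqnormq x != 0 by rewrite sqnormq_eq0.
have cV a : (a / sqnormq x)^* = a^* / sqnormq x.
  by rewrite rmorphM /= conjc_inv sqnormq_conj.
apply: quat_eq; rewrite ?qfstM ?qsndM /= cV ?conjcK ?rmorphN /=.
  by apply: (mulIf N0); rewrite mul1r [RHS]/sqnormq; field.
by field.
Qed.

Fact quat_unitP x y : y * x = 1 /\ x * y = 1 -> [pred x : H | x != 0] x.
Proof.
case=> yx _ /=; apply: contra_eq_neq yx => ->.
by rewrite mulr0 eq_sym oner_neq0.
Qed.

Fact quat_inv_out : {in [predC [pred x : H | x != 0]], quat_inv =1 id}.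
Proof. by move=> x; rewrite !inE negbK /quat_inv => ->. Qed.

HB.instance Definition _ := GRing.NzRing_hasMulInverse.Build H
  quat_mulVq quat_mulqV quat_unitP quat_inv_out.

Lemma quat_unitE x : (x \is a GRing.unit) = (x != 0).
Proof. by []. Qed.

Lemma quat_mulVr x : x != 0 -> x^-1 * x = 1.
Proof. by rewrite -quat_unitE => /mulVr. Qed.

Lemma quat_mulrV x : x != 0 -> x * x^-1 = 1.
Proof. by rewrite -quat_unitE => /mulrV. Qed.

Definition quatC a : H := Quat a 0.

Fact quatC_additive : zmod_morphism quatC.
Proof. by move=> a b; apply: quat_eq; rewrite //= subrr. Qed.

Fact quatC_multiplicative : monoid_morphism quatC.
Proof.
split=> // a b; apply: quat_eq; rewrite ?qfstM ?qsndM /=.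
  by rewrite mul0r subr0.
by rewrite mulr0 mul0r addr0.
Qed.

HB.instance Definition _ := GRing.isZmodMorphism.Build C H quatC quatC_additive.
HB.instance Definition _ :=
  GRing.isMonoidMorphism.Build C H quatC quatC_multiplicative.

Lemma quatC_inj : injective quatC.
Proof. by move=> a b []. Qed.

Lemma quatC_eq0 a : (quatC a == 0) = (a == 0).
Proof. by rewrite -(inj_eq quatC_inj) rmorph0. Qed.

Local Notation qj := (quat_j R).

Lemma quat_jC a : qj * quatC a = quatC a^* * qj.
Proof. by apply: quat_eq; rewrite ?qfstM ?qsndM /= ?conjc0 ?conjc1; ring. Qed.

Lemma quat_jj : qj * qj = -1.
Proof. by have [] := hamilton R. Qed.

(* Conjugating by [j] turns the eigenvalue [a] of a quaternionic matrix into
   its complex conjugate, so the closed upper half plane meets every class. *)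
Definition upper a := 0 <= complex.Im a.

Lemma upper_conj a : upper a || upper a^*.
Proof. by case: a => a b; rewrite /upper /= oppr_ge0 le_total. Qed.

Lemma upper_inj a b : upper a -> upper b -> a = b \/ a = b^* -> a = b.
Proof.
case: a b => [a1 a2] [b1 b2]; rewrite /upper /= => a0 b0 [//|[-> a2E]].
have /eqP: a2 + b2 = 0 by rewrite a2E addNr.
by rewrite paddr_eq0 // => /andP[/eqP-> /eqP->].
Qed.

Lemma upper_Vconj a : upper a -> upper (a^*)^-1.
Proof.
case: a => u v; rewrite /upper /= => v0.
by rewrite sqrrN mulNr opprK divr_ge0 // addr_ge0 ?sqr_ge0.
Qed.

Lemma upper_NV a : upper a -> upper (- a^-1).
Proof.
case: a => u v; rewrite /upper /= => v0.
by rewrite ?opprK divr_ge0 // addr_ge0 ?sqr_ge0.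
Qed.

(* Solving the Sylvester equation componentwise in [H = C + C j] leaves only
   the resonant part [x'], which satisfies [x' a = b x']; in the resonant
   components the division by 0 below gives [t = 0]. *)
Lemma sylvester a b x : exists t : H,
  (x + t * quatC a - quatC b * t) * quatC a =
  quatC b * (x + t * quatC a - quatC b * t).
Proof.
have res (d s : C) : (s - s / d * d) * d = 0.
  by have [->|d0] := eqVneq d 0; rewrite ?mulr0 // divfK // subrr mul0r.
exists (Quat (- (qfst x / (a - b))) (- (qsnd x / (a^* - b)))).
set e1 := res (a - b) (qfst x); set e2 := res (a^* - b) (qsnd x).
apply/eqP; rewrite -subr_eq0; apply/eqP.
apply: quat_eq; rewrite !(raddfB, raddfD, qfstM, qsndM) /=.
  by rewrite -[RHS]e1 ?conjc0; ring.
by rewrite -[RHS]e2 ?conjc0; ring.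
Qed.

(** In [x = x1 + x2 j], the component [x1] commutes with complex numbers and [x2 j] conjugates them,
    so a nonzero [x1] forces [b = a] and a nonzero [x2] forces [b = a^*]. *)
Lemma intertwine_eigen a b x :
  x * quatC a = quatC b * x -> x != 0 -> b = a \/ b = a^*.
Proof.
move=> e x0; have [x1|x1] := eqVneq (qfst x) 0; last first.
  left; have := congr1 (@qfst R) e; rewrite !qfstM /= conjc0 mulr0 mul0r !subr0.
  by rewrite [b * _]mulrC => /(mulfI x1).
have x2 : qsnd x != 0.
  by apply: contraNneq x0 => x2; apply/eqP/quat_eq; rewrite ?x1 ?x2.
right; have := congr1 (@qsnd R) e; rewrite !qsndM /= mulr0 mul0r addr0 add0r.
by rewrite [b * _]mulrC => /(mulfI x2).
Qed.

Lemma intertwine_upper a b x : upper a -> upper b ->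
  x * quatC a = quatC b * x -> x != 0 -> a = b.
Proof.
by move=> ua ub e x0; apply/esym/(upper_inj ub ua)/(intertwine_eigen e x0).
Qed.

End QuaternionInverse.

(** * Triangularization over the quaternions *)

Section Similarity.
Variable K : nzRingType.

Definition sim_mx n (A B : 'M[K]_n) :=
  exists P Q : 'M[K]_n, [/\ P *m Q = 1%:M, Q *m P = 1%:M & P *m A = B *m P].

Lemma sim_mx_trans n (B A C : 'M[K]_n) :
  sim_mx A B -> sim_mx B C -> sim_mx A C.
Proof.
move=> [P1 [Q1 [PQ1 QP1 e1]]] [P2 [Q2 [PQ2 QP2 e2]]].
exists (P2 *m P1), (Q1 *m Q2); split.
- by rewrite mulmxA -(mulmxA P2) PQ1 mulmx1.
- by rewrite mulmxA -(mulmxA Q1) QP2 mulmx1.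
- by rewrite -mulmxA e1 mulmxA e2 mulmxA.
Qed.

End Similarity.

Section Triangularization.
Variable R : rcfType.
Local Notation C := R[i].
Local Notation H := (quat R).

(** Once a transposition has moved a nonzero coordinate to the front, the row is the first row of a
    triangular matrix with an explicit inverse. *)
Lemma complete_row n (v : 'rV[H]_(1 + n)) : v != 0 ->
  exists P Q : 'M[H]_(1 + n),
    [/\ P *m Q = 1%:M, Q *m P = 1%:M & usubmx P = v].
Proof.
case/rV0Pn=> i vi.
pose s : 'M[H]_(1 + n) := tperm_mx 0 i; pose w : 'rV[H]_(1 + n) := v *m s.
have ss : s *m s = 1%:M by rewrite -perm_mxM tperm2 perm_mx1.
set u := v 0 i in vi.
have wl : lsubmx w = u%:M.
  by apply/rowP => j; rewrite ord1 mxE /w -xcolE !mxE lshift0 tpermL eqxx.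
pose P : 'M_(1 + n) := block_mx u%:M (rsubmx w) 0 1%:M.
pose Q : 'M_(1 + n) := block_mx (u^-1)%:M (- (u^-1 *: rsubmx w)) 0 1%:M.
exists (P *m s), (s *m Q); split.
- rewrite mulmxA -(mulmxA P) ss mulmx1 /P /Q mulmx_block.
  rewrite !(mulmx0, mul0mx, mulmx1, mul_scalar_mx, addr0, add0r).
  rewrite scale_scalar_mx scalerN scalerA quat_mulrV // !scale1r addNr.
  by rewrite [RHS]scalar_mx_block.
- rewrite mulmxA -(mulmxA s).
  have -> : Q *m P = 1%:M; last by rewrite mulmx1 ss.
  rewrite /P /Q mulmx_block !(mulmx0, mul0mx, mulmx1, mul_scalar_mx, addr0).
  rewrite add0r scale_scalar_mx quat_mulVr // !scale1r subrr add0r.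
  by rewrite [RHS]scalar_mx_block.
have uP : usubmx P = w by rewrite /P block_mxEv col_mxKu -wl hsubmxK.
by rewrite -mul_usub_mx uP /w -mulmxA ss mulmx1.
Qed.

Lemma quat_eigenvector n (g : 'M[H]_n.+1) :
  exists (v : 'rV[H]_n.+1) a, [/\ v != 0, upper a & v *m g = quatC a *: v].
Proof.
have /closed_rootP[a] : size (char_poly (Phi g)) != 1 by rewrite size_char_poly.
rewrite -eigenvalue_root_char => /eigenvalueP[w wg w0].
(* The row [(w1, w2)] is the top row of the complex adjoint of [w1 + w2 j], so multiplying it by
   [Phi g] amounts to multiplying [w1 + w2 j] by [g]. *)
pose v : 'rV[H]_n.+1 := \row_j Quat (lsubmx w 0 j) (rsubmx w 0 j).
have v0 : v != 0.
  apply: contraNneq w0 => v0; rewrite -[w]hsubmxK row_mx_eq0.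
  by apply/andP; split; apply/eqP/rowP => j; have /rowP/(_ j) := v0;
    rewrite !mxE => -[].
have vg : v *m g = quatC a *: v.
  move: wg; rewrite -{1}[w]hsubmxK /Phi mul_row_block => /rowP wg.
  apply/rowP => j; have := wg (lshift _ j); have := wg (rshift _ j).
  rewrite row_mxEl row_mxEr !mxE => e2 e1.
  apply: quat_eq; rewrite [RHS](qfstM, qsndM) /= ?mul0r ?subr0 ?addr0.
    rewrite -e1 raddf_sum /= -big_split /=; apply: eq_bigr => k _.
    by rewrite !mxE /= mulrN.
  rewrite -e2 raddf_sum /= -big_split /=; apply: eq_bigr => k _.
  by rewrite !mxE /=.
have [ua|ua] := orP (upper_conj a); first by exists v, a.
exists (quat_j R *: v), a^*; split=> //.
  apply: contra_neq v0 => /(congr1 (fun x => - quat_j R *: x)).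
  by rewrite scalerA mulNr quat_jj opprK scale1r scaler0.
by rewrite -scalemxAl vg !scalerA quat_jC.
Qed.

(** Deflation: in a basis starting with a row eigenvector the first row becomes [(a, 0)], and the
    induction treats the lower right block. *)
Lemma triangularize n (g : 'M[H]_n) : exists T, [/\ sim_mx g T, is_trig_mx T
  & forall i, exists2 a, upper a & T i i = quatC a].
Proof.
elim: n g => [|n IHn] g.
  exists g; split; last by case.
    by exists 1%:M, 1%:M; rewrite !mulmx1 mul1mx.
  by apply/is_trig_mxP => -[].
have [v [a [v0 ua vg]]] := quat_eigenvector g.
have [P [Q [PQ QP rP]]] := complete_row v0.
pose B : 'M_(1 + n) := P *m g *m Q.
have Bu : usubmx B = row_mx (quatC a)%:M 0.
  rewrite /B -!mul_usub_mx rP vg -scalemxAl -rP mul_usub_mx PQ.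
  rewrite scalar_mx_block block_mxEv col_mxKu.
  by rewrite scale_row_mx scaler0 scale_scalar_mx mulr1.
have [T [[P' [Q' [PQ' QP' e']]] Ttrig Tdiag]] := IHn (drsubmx B).
have BE : B = block_mx (quatC a)%:M 0 (dlsubmx B) (drsubmx B).
  by rewrite -{1}[B]submxK -{1}[ulsubmx B]/(lsubmx _)
    -{1}[ursubmx B]/(rsubmx _) Bu row_mxKl row_mxKr.
exists (block_mx (quatC a)%:M 0 (P' *m dlsubmx B) T); split.
- apply: (@sim_mx_trans _ _ B).
    by exists P, Q; rewrite /B -!mulmxA QP mulmx1.
  exists (block_mx 1%:M 0 0 P'), (block_mx 1%:M 0 0 Q').
  rewrite BE !mulmx_block.
  rewrite !(mulmx0, mul0mx, mulmx1, mul1mx, addr0, add0r) PQ' QP' e'.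
  by rewrite -!scalar_mx_block block_mxKdl; split.
- have := is_trig_block_mx (quatC a)%:M 0 (P' *m dlsubmx B) T (erefl 1%N).
  by rewrite eqxx Ttrig mx11_is_trig.
move=> i; have := splitK (i : 'I_(1 + n)); case: (split _) => j /= <-.
  exists a => //; apply: etrans (block_mxEul _ _ _ _ j j) _.
  by rewrite ord1 mxE.
by have [b ub Tb] := Tdiag j; exists b; rewrite // -Tb; apply: block_mxEdr.
Qed.

End Triangularization.

(** * Jordan form of 3x3 quaternionic matrices *)

Section LowerTriangular3.

Definition lt3 (K : nmodType) (a b c x y z : K) : 'M[K]_3 :=
  \matrix_(i, j) nth 0 (nth [::] [:: [:: a]; [:: x; b]; [:: y; z; c]] i) j.

Lemma lt3_of_trig (K : nmodType) (T : 'M[K]_3) : is_trig_mx T ->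
  exists x y z, T = lt3 (T 0 0) (T 1 1) (T 2 2) x y z.
Proof.
move/is_trig_mxP=> T0; exists (T 1 0), (T 2 0), (T 2 1); apply/matrixP.
case=> [[|[|[|i]]] // hi] [[|[|[|j]]] // hj]; rewrite mxE /=; try exact: T0;
  by congr (T _ _); apply: val_inj.
Qed.

Lemma lt3M (K : pzSemiRingType) (a b c x y z a' b' c' x' y' z' : K) :
  lt3 a b c x y z *m lt3 a' b' c' x' y' z' =
  lt3 (a * a') (b * b') (c * c') (x * a' + b * x')
      (y * a' + z * x' + c * y') (z * b' + c * z').
Proof.
apply/matrixP => i j; rewrite !mxE !big_ord_recl big_ord0 !mxE.
case: i j => [[|[|[|i]]] // hi] [[|[|[|j]]] // hj];
  by rewrite /= ?(mulr0, mul0r, addr0, add0r) ?addrA.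
Qed.

Lemma lt3_1 (K : pzSemiRingType) : lt3 1 1 1 0 0 0 = 1%:M :> 'M[K]_3.
Proof.
by apply/matrixP; case=> [[|[|[|i]]] // hi] [[|[|[|j]]] // hj]; rewrite !mxE.
Qed.

Lemma map_lt3 (K L : nmodType) (f : {additive K -> L}) (a b c x y z : K) :
  map_mx f (lt3 a b c x y z) = lt3 (f a) (f b) (f c) (f x) (f y) (f z).
Proof.
by apply/matrixP; case=> [[|[|[|i]]] // hi] [[|[|[|j]]] // hj];
  rewrite !mxE /= ?raddf0.
Qed.

Lemma det_lt3 (K : comPzRingType) (a b c x y z : K) :
  \det (lt3 a b c x y z) = a * b * c.
Proof.
rewrite det_trig; first by rewrite !big_ord_recl big_ord0 !mxE /= mulr1 mulrA.
by apply/is_trig_mxP; case=> [[|[|[|i]]] // hi] [[|[|[|j]]] // hj]; rewrite mxE.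
Qed.

Section Conjugation.
Variable K : nzRingType.
Implicit Types a b c x y z t : K.

Lemma sim_lt3_21 t a b c x y z :
  sim_mx (lt3 a b c x y z) (lt3 a b c (x + t * a - b * t) (y - z * t) z).
Proof.
exists (lt3 1 1 1 t 0 0), (lt3 1 1 1 (- t) 0 0); rewrite !lt3M -lt3_1.
by split; congr lt3; rewrite ?(mulr0, mul0r, mulr1, mul1r, addr0, add0r) //;
  rewrite ?subrr ?addNr ?subrK // addrC.
Qed.

Lemma sim_lt3_32 t a b c x y z :
  sim_mx (lt3 a b c x y z) (lt3 a b c x (y + t * x) (z + t * b - c * t)).
Proof.
exists (lt3 1 1 1 0 0 t), (lt3 1 1 1 0 0 (- t)); rewrite !lt3M -lt3_1.
by split; congr lt3; rewrite ?(mulr0, mul0r, mulr1, mul1r, addr0, add0r) //;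
  rewrite ?subrr ?addNr ?subrK // addrC.
Qed.

Lemma sim_lt3_31 t a b c x y z :
  sim_mx (lt3 a b c x y z) (lt3 a b c x (y + t * a - c * t) z).
Proof.
exists (lt3 1 1 1 0 t 0), (lt3 1 1 1 0 (- t) 0); rewrite !lt3M -lt3_1.
by split; congr lt3; rewrite ?(mulr0, mul0r, mulr1, mul1r, addr0, add0r) //;
  rewrite ?subrr ?addNr ?subrK // addrC.
Qed.

End Conjugation.
End LowerTriangular3.

Section JordanForm.
Variable R : rcfType.
Local Notation C := R[i].
Local Notation H := (quat R).

Lemma sim_lt3_diag (s t a b c x y z : H) : s != 0 -> t != 0 ->
  s * b = b * s -> t * c = c * t ->
  sim_mx (lt3 a b c x y z) (lt3 a b c (s * x) (t * y) (t * z * s^-1)).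
Proof.
move=> s0 t0 sb tc; exists (lt3 1 s t 0 0 0), (lt3 1 s^-1 t^-1 0 0 0).
rewrite !lt3M -lt3_1.
split; congr lt3; rewrite ?(mulr0, mul0r, mulr1, mul1r, addr0, add0r) //;
  rewrite ?quat_mulrV ?quat_mulVr //.
by rewrite divrK ?quat_unitE.
Qed.

Lemma quat_intertwineV (x a b : H) : x != 0 -> x * a = b * x ->
  x^-1 * b = a * x^-1.
Proof.
move=> x0 e; rewrite -[LHS]mulr1 -(quat_mulrV x0) -mulrA [b * _]mulrA -e.
by rewrite !mulrA quat_mulVr // mul1r.
Qed.

(** If [x] is nonzero then [a = b] and [x] commutes with it; hence so does [u(b) x^-1], which is
    nonzero and scales [x] to [u b]. *)
Lemma rescale (u : C -> C) (u0 : forall a, u a != 0) (a b : C) (x : H) :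
  upper a -> upper b -> x * quatC a = quatC b * x ->
  exists s : H, [/\ s != 0, s * quatC b = quatC b * s &
    x = 0 \/ a = b /\ s * x = quatC (u b)].
Proof.
move=> ua ub e; have [x0|x0] := eqVneq x 0.
  by exists 1; rewrite oner_eq0 mulr1 mul1r; split=> //; left.
have ab := intertwine_upper ua ub e x0; rewrite ab in e.
have s0 : quatC (u b) * x^-1 != 0.
  apply: contraNneq (u0 b) => /(congr1 (fun t => t * x)).
  by rewrite -mulrA quat_mulVr // mulr1 mul0r => /eqP; rewrite quatC_eq0.
exists (quatC (u b) * x^-1); split=> //; last first.
  by right; rewrite -mulrA quat_mulVr // mulr1.
by rewrite -mulrA (quat_intertwineV x0 e) !mulrA -!rmorphM mulrC.
Qed.

(** Jordan patterns with [u] of the eigenvalue in place of 1: diagonal, one block of size 2 on rows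
    0-1, 1-2 or 0-2, and one block of size 3. *)
Definition jordan_entries (u : C -> C) (a b c x y z : C) : Prop :=
  [\/ [/\ x = 0, y = 0 & z = 0],
      [/\ b = a, x = u a, y = 0 & z = 0],
      [/\ c = b, x = 0, y = 0 & z = u b]
   |  [/\ c = a, x = 0, y = u a & z = 0]
   \/ [/\ b = a /\ c = a, x = u a, y = 0 & z = u a]].

(* The intertwining relations make the block of each eigenvalue [a] a matrix
   over its centralizer in [H], which is a division ring: over it the nilpotent
   part is reduced as over a field. *)
Lemma quat_jordan3 (u : C -> C) (u0 : forall a, u a != 0) (g : 'M[H]_3) :
  exists a b c x y z, [/\ sim_mx g (map_mx (@quatC R) (lt3 a b c x y z)),
    [/\ upper a, upper b & upper c] & jordan_entries u a b c x y z].
Proof.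
have [T [gT Ttrig Tdiag]] := triangularize g.
have [x [y [z TE]]] := lt3_of_trig Ttrig.
have [a ua aE] := Tdiag 0; have [b ub bE] := Tdiag 1.
have [c uc cE] := Tdiag 2.
rewrite TE aE bE cE {T Ttrig Tdiag TE aE bE cE} in gT.
(* The corner [y] comes last: reducing [x] or [z] alters [y] as well, but neither affects the other,
   and reducing [y] affects nothing else. *)
have [t hx] := sylvester a b x.
have {gT}gT := sim_mx_trans gT (sim_lt3_21 t _ _ _ _ _ _).
move: hx gT; move: (x + _ - _) (y - _) => {}x {}y hx gT {t}.
have [t hz] := sylvester b c z.
have {gT}gT := sim_mx_trans gT (sim_lt3_32 t _ _ _ _ _ _).
move: hz gT; move: (z + _ - _) (y + _) => {}z {}y hz gT {t}.
have [t hy] := sylvester a c y.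
have {gT}gT := sim_mx_trans gT (sim_lt3_31 t _ _ _ _ _ _).
move: hy gT; move: (y + _ - _) => {}y hy gT {t}.
have {hy gT}[y' [gT hy xyz]] : exists y', [/\
    sim_mx g (lt3 (quatC a) (quatC b) (quatC c) x y' z),
    y' * quatC a = quatC c * y' & y' = 0 \/ x = 0 /\ z = 0].
  (* For [z] nonzero, [z^-1 y] intertwines [a] and [b], so the conjugation it defines fixes [x] and
     cancels [y]. For [x] nonzero, [- y x^-1] intertwines [b] and [c], fixes [z] and cancels [y]. *)
  have [z0|z0] := eqVneq z 0; last first.
    exists 0; split; [|by rewrite mulr0 mul0r|by left].
    have := sim_mx_trans gT (sim_lt3_21 (z^-1 * y) _ _ _ _ _ _).
    rewrite -(mulrA z^-1) hy mulrA (quat_intertwineV z0 hz) -mulrA addrK.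
    by rewrite mulrA quat_mulrV // mul1r subrr.
  have [x0|x0] := eqVneq x 0; last first.
    exists 0; split; [|by rewrite mulr0 mul0r|by left].
    have tb : y / x * quatC b = quatC c * (y / x).
      by rewrite -mulrA (quat_intertwineV x0 hx) !mulrA hy.
    have := sim_mx_trans gT (sim_lt3_32 (- (y / x)) _ _ _ _ _ _).
    by rewrite mulrN !mulNr opprK tb subrK divrK ?quat_unitE // subrr.
  by exists y; split=> //; right.
have [s [s0 sb xE]] := rescale u0 ua ub hx.
(* Normalising [x] by [s] turns [z] into [z s^-1], which is what [t1] must normalise; [t2] serves
   the case where only [y] survives. *)
have hzs : z * s^-1 * quatC b = quatC c * (z * s^-1).
  by rewrite -mulrA (quat_intertwineV s0 sb) !mulrA hz.
have [t1 [t10 t1c zE]] := rescale u0 ub uc hzs.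
have [t2 [t20 t2c yE]] := rescale u0 ua uc hy.
have zs0 : z = 0 <-> z * s^-1 = 0.
  split=> [->|/(congr1 (fun t => t * s))]; first by rewrite mul0r.
  by rewrite -mulrA quat_mulVr // mulr1 mul0r.
have G1 := sim_mx_trans gT (sim_lt3_diag _ _ _ _ s0 t10 sb t1c).
have G2 := sim_mx_trans gT (sim_lt3_diag _ _ _ _ s0 t20 sb t2c).
have qu := rmorph0 (@quatC R).
have up : [/\ upper a, upper b & upper c] by [].
case: xyz => [y0|[x0 z0]]; last first.
  rewrite x0 z0 !(mulr0, mul0r) in G2.
  case: yE => [y0|[ac tE]].
    exists a, b, c, 0, 0, 0; rewrite map_lt3 /= !qu; split=> //.
      by rewrite y0 mulr0 in G2.
    by apply: Or41.
  exists a, b, c, 0, (u a), 0; rewrite map_lt3 /= !qu; split=> //.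
    by move: G2; rewrite tE ac.
  by apply: Or44; left.
rewrite y0 mulr0 -mulrA in G1.
case: xE zE => [x0|[ab xE]] [/zs0 z0|[bc zE]].
- exists a, b, c, 0, 0, 0; rewrite map_lt3 /= !qu; split=> //.
    by rewrite x0 z0 !(mulr0, mul0r) in G1.
  by apply: Or41.
- exists a, b, c, 0, 0, (u b); rewrite map_lt3 /= !qu; split=> //.
    by move: G1; rewrite x0 zE mulr0 bc.
  by apply: Or43.
- exists a, b, c, (u a), 0, 0; rewrite map_lt3 /= !qu; split=> //.
    by move: G1; rewrite xE z0 !(mulr0, mul0r) ab.
  by apply: Or42.
exists a, b, c, (u a), 0, (u a); rewrite map_lt3 /= !qu; split=> //.
  by move: G1; rewrite xE zE ab bc.
by apply: Or44; right; rewrite -bc -ab.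
Qed.

End JordanForm.

(** * Reversing complex matrices *)

Section ComplexMatrices.
Variables (R : rcfType) (n : nat).
Local Notation C := R[i].
Local Notation H := (quat R).
Implicit Types M D : 'M[C]_n.
Implicit Types g h : 'M[H]_n.

Definition liftC M : 'M[H]_n := map_mx (@quatC R) M.

Lemma liftCM M D : liftC (M *m D) = liftC M *m liftC D.
Proof. exact: map_mxM. Qed.

Lemma detH_liftC M : detH (liftC M) = \det M * (\det M)^*.
Proof.
have e1 : cpart1 (liftC M) = M by apply/matrixP => i j; rewrite !mxE.
have e2 : cpart2 (liftC M) = 0 by apply/matrixP => i j; rewrite !mxE.
by rewrite /detH /Phi e1 e2 map_mx0 oppr0 det_ublock det_map_mx.
Qed.

Lemma detH_j : detH ((quat_j R)%:M : 'M_n) = 1.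
Proof.
have e1 : @cpart1 R n (quat_j R)%:M = 0.
  by apply/matrixP => i j; rewrite !mxE raddfMn /= mul0rn.
have e2 : @cpart2 R n (quat_j R)%:M = 1%:M.
  by apply/matrixP => i j; rewrite !mxE raddfMn.
(* The complex adjoint of the scalar matrix [j] has blocks 0, 1, -1, 0; it factors as [U L U] with
   unitriangular factors. *)
pose U : 'M[C]_(n + n) := block_mx 1%:M 1%:M 0 1%:M.
pose L : 'M[C]_(n + n) := block_mx 1%:M 0 (- 1%:M) 1%:M.
have -> : detH ((quat_j R)%:M : 'M_n) = \det (U *m L *m U).
  rewrite /detH /Phi e1 e2 map_mx0 map_mx1 /U /L !mulmx_block.
  rewrite !(mulmx0, mul0mx, mulmx1, mul1mx, add0r, addr0).
  by rewrite subrr add0r addNr.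
by rewrite !det_mulmx /U /L !(det_ublock, det_lblock) !det1 !mulr1.
Qed.

Lemma liftC_j M : liftC M *m (quat_j R)%:M = quat_j R *: liftC (map_mx conjc M).
Proof.
apply/matrixP => i j; rewrite !mxE (bigD1 j) //= big1 => [|k /negPf kj].
  by rewrite addr0 !mxE eqxx mulr1n quat_jC conjcK.
by rewrite !mxE kj mulr0.
Qed.

(** Strong reversibility in the projective group, read on matrix lifts: both relations hold up to
    sign, and the second is stated without inverses. *)
Definition reversed_by_involution g := exists h,
  [/\ detH h = 1, h *m h = 1%:M \/ h *m h = - 1%:M
    & g *m h *m g = h \/ g *m h *m g = - h].

Lemma reversed_sim g g' :
  sim_mx g g' -> reversed_by_involution g' -> reversed_by_involution g.
Proof.
move=> [P [Q [PQ QP e]]] [h [dh hh ghg]].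
have gE : g = Q *m g' *m P by rewrite -mulmxA -e mulmxA QP mul1mx.
exists (Q *m h *m P); split.
- by rewrite !detHM dh mulr1 -detHM QP detH1.
- have -> : Q *m h *m P *m (Q *m h *m P) = Q *m (h *m h) *m P.
    by rewrite !mulmxA -(mulmxA (Q *m h)) PQ mulmx1.
  by case: hh => ->; [left|right]; rewrite ?(mulmxN, mulNmx) mulmx1 QP.
have -> : g *m (Q *m h *m P) *m g = Q *m (g' *m h *m g') *m P.
  rewrite gE !mulmxA -(mulmxA _ P Q) PQ mulmx1.
  by rewrite -(mulmxA _ P Q) PQ mulmx1.
by case: ghg => ->; [left|right]; rewrite ?(mulmxN, mulNmx).
Qed.

Lemma real_involution_det D : map_mx conjc D = D -> D *m D = 1%:M ->
  detH (liftC D) = 1.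
Proof.
by move=> rD DD; rewrite detH_liftC -det_map_mx rD -det_mulmx DD det1.
Qed.

Lemma reversed_linear M D : map_mx conjc D = D -> D *m D = 1%:M ->
  M *m D *m M = - D -> reversed_by_involution (liftC M).
Proof.
move=> rD DD MDM; exists (liftC D); split.
- exact: real_involution_det.
- by left; rewrite -liftCM DD /liftC map_mx1.
by right; rewrite -!liftCM MDM /liftC map_mxN.
Qed.

(** A real [D] commutes with [j], so [(j D)^2 = - D^2 = -1], while [M j D M = j M^* D M = j D]. *)
Lemma reversed_antilinear M D : map_mx conjc D = D -> D *m D = 1%:M ->
  map_mx conjc M *m D *m M = D -> reversed_by_involution (liftC M).
Proof.
move=> rD DD MDM; exists ((quat_j R)%:M *m liftC D); split.
- by rewrite detHM detH_j real_involution_det ?mulr1.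
- right; rewrite mulmxA -(mulmxA _ _ (_)%:M) liftC_j rD.
  rewrite mul_scalar_mx scalerA quat_jj -scalemxAl -liftCM DD.
  by rewrite /liftC map_mx1 scaleN1r.
left; rewrite !mulmxA liftC_j mul_scalar_mx -!scalemxAl -!liftCM.
by rewrite MDM.
Qed.

Lemma reversed_diag (d : 'rV[C]_n) (s : 'S_n) : (s * s = 1)%g ->
  (forall k, (d 0 k)^* * d 0 (s k) = 1) \/ (forall k, d 0 k * d 0 (s k) = -1) ->
  reversed_by_involution (liftC (diag_mx d)).
Proof.
move=> ss ds; have rS : map_mx conjc (perm_mx s) = perm_mx s :> 'M[C]_n.
  exact: map_perm_mx.
have SS : perm_mx s *m perm_mx s = 1%:M :> 'M[C]_n.
  by rewrite -perm_mxM ss perm_mx1.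
case: ds => ds.
  apply: (reversed_antilinear rS SS).
  rewrite map_diag_mx mul_diag_mx mul_mx_diag.
  apply/matrixP => i j; rewrite !mxE.
  by case: eqP => [<-|_]; rewrite ?(mulr0, mul0r) // mulr1 ds.
apply: (reversed_linear rS SS); rewrite mul_diag_mx mul_mx_diag.
apply/matrixP => i j; rewrite !mxE.
by case: eqP => [<-|_]; rewrite ?(mulr0, mul0r, oppr0) // mulr1 ds.
Qed.

End ComplexMatrices.

(** * Pairing of the eigenvalues *)

Section Reversibility.
Variable R : rcfType.
Local Notation C := R[i].
Local Notation H := (quat R).
Implicit Types (a b c p q r : C).

(** A row with no entry off the diagonal yields a basis vector as eigenvector. A row with such an
    entry repeats the eigenvalue of an earlier row, where the search continues. *)
Lemma jordan_eigenvector u a b c x y z p : jordan_entries u a b c x y z ->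
  p \in [:: a; b; c] ->
  exists2 v : 'rV[C]_3, v != 0 & v *m lt3 a b c x y z = p *: v.
Proof.
move=> J pabc.
have e_neq0 (i : 'I_3) : delta_mx 0 i != 0 :> 'rV[C]_3.
  by apply/rV0Pn; exists i; rewrite mxE !eqxx oner_eq0.
have eig i : (forall k, lt3 a b c x y z i k = p *+ (i == k)) ->
    exists2 v : 'rV[C]_3, v != 0 & v *m lt3 a b c x y z = p *: v.
  move=> row_i; exists (delta_mx 0 i) => //; rewrite -rowE.
  by apply/rowP => k; rewrite [LHS]mxE row_i !mxE eqxx eq_sym mulr_natr.
have ea : p = a -> exists2 v : 'rV[C]_3, v != 0 & v *m lt3 a b c x y z = p *: v.
  move=> pa; apply: (eig 0); case=> [[|[|[|k]]] // hk];
  by rewrite mxE pa.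
have eb : p = b -> x = 0 ->
    exists2 v : 'rV[C]_3, v != 0 & v *m lt3 a b c x y z = p *: v.
  move=> pb x0; apply: (eig 1); case=> [[|[|[|k]]] // hk];
  by rewrite mxE pb ?x0.
have ec : p = c -> y = 0 -> z = 0 ->
    exists2 v : 'rV[C]_3, v != 0 & v *m lt3 a b c x y z = p *: v.
  move=> pc y0 z0; apply: (eig 2); case=> [[|[|[|k]]] // hk];
  by rewrite mxE pc ?y0 ?z0.
move: pabc; rewrite !inE => /or3P[] /eqP pE; first exact: ea.
  by case: J => [[]|[]|[]|[[]|[[]]]] *; (apply: ea + apply: eb); congruence.
by case: J => [[]|[]|[]|[[]|[[]]]] *; (apply: ea + apply: eb + apply: ec);
  congruence.
Qed.

(** By triangularity, the last nonzero coordinate of [v] intertwines [p] with the diagonal entry at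
    its position. *)
Lemma lt3_quat_eigenvalue a b c x y z p (v : 'rV[H]_3) : v != 0 ->
  v *m liftC (lt3 a b c x y z) = quatC p *: v ->
  exists2 q, q \in [:: a; b; c] & p = q \/ p = q^*.
Proof.
move=> v0 vM; have col k := congr1 (fun w : 'rV[H]_3 => w 0 k) vM.
have := col 0; have := col 1; have := col 2.
rewrite /liftC map_lt3 !mxE !big_ord_recl !big_ord0 !mxE /=.
have -> : lift ord0 ord0 = 1 :> 'I_3 by apply: val_inj.
have -> : lift ord0 (lift ord0 ord0) = 2 :> 'I_3 by apply: val_inj.
rewrite ?(mulr0, addr0, add0r) => c2 c1 c0.
have eigenvalue_at q k :
    q \in [:: a; b; c] -> v 0 k * quatC q = quatC p * v 0 k ->
    v 0 k != 0 -> exists2 q, q \in [:: a; b; c] & p = q \/ p = q^*.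
  by move=> qabc e vk; exists q => //; apply: intertwine_eigen e vk.
have [v2|v2] := eqVneq (v 0 2) 0; last first.
  by apply: eigenvalue_at c2 v2; rewrite !inE eqxx !orbT.
have [v1|v1] := eqVneq (v 0 1) 0; last first.
  rewrite v2 mul0r addr0 in c1.
  by apply: eigenvalue_at c1 v1; rewrite !inE eqxx !orbT.
have v00 : v 0 0 != 0.
  apply: contraNneq v0 => v00; apply/eqP/rowP => -[[|[|[|k]]] // hk];
    rewrite mxE; [rewrite -v00|rewrite -v1|rewrite -v2]; congr (v _ _);
    exact: val_inj.
rewrite v1 v2 !mul0r !addr0 in c0.
by apply: eigenvalue_at c0 v00; rewrite !inE eqxx.
Qed.

Lemma normC_eq1 a : `|a| = 1 <-> a^* * a = 1.
Proof.
rewrite mulrC -sqr_normc; split=> [->|/eqP]; first by rewrite expr1n.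
by rewrite sqrp_eq1 // => /eqP.
Qed.

Lemma jordan_unimodular u a b c x y z : jordan_entries u a b c x y z ->
  u a = a -> u b = b -> a^* * a = 1 -> b^* * b = 1 -> c^* * c = 1 ->
  reversed_by_involution (liftC (lt3 a b c x y z)).
Proof.
move=> J ua ub aa bb cc.
have N1 : (-1 : C)^* = -1 by rewrite rmorphN /= conjc1.
(* Since [M = a (1 + N)] on a block, [D] must satisfy [(1 + N) D (1 + N) = D]. Alternating signs
   make [N D + D N] vanish, and on a block of size 3 the entry [t = 1] cancels the remaining
   [N D N]. *)
pose D t : 'M[C]_3 := lt3 1 (-1) 1 0 0 t.
have rev t M : t^* = t -> map_mx conjc M *m D t *m M = D t ->
    reversed_by_involution (liftC M).
  move=> tt; apply: reversed_antilinear.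
    by rewrite map_lt3 /= conjc0 conjc1 N1 tt.
  by rewrite lt3M -lt3_1; congr lt3; ring.
case: J => [[-> -> ->]|[ba -> -> ->]|[cb -> -> ->]|
    [[ca -> -> ->]|[[ba ca] -> -> ->]]]; rewrite ?(ua, ub).
- apply: (rev 0 _ (conjc0 R)).
  by rewrite map_lt3 !lt3M /= ?conjc0; congr lt3; ring: aa bb cc.
- apply: (rev 0 _ (conjc0 R)).
  by rewrite ba map_lt3 !lt3M /= ?conjc0; congr lt3; ring: aa bb cc.
- apply: (rev 1 _ (conjc1 R)).
  by rewrite cb map_lt3 !lt3M /= ?conjc0; congr lt3; ring: aa bb cc.
(* The block sits on rows 0 and 2, which must now carry opposite signs. *)
- apply: (@reversed_antilinear _ _ _ (lt3 1 1 (-1) 0 0 0)).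
  + by rewrite map_lt3 /= conjc0 conjc1 N1.
  + by rewrite lt3M -lt3_1; congr lt3; ring.
  + by rewrite ca map_lt3 !lt3M /= ?conjc0; congr lt3; ring: aa bb cc.
apply: (rev 1 _ (conjc1 R)).
by rewrite ba ca map_lt3 !lt3M /= ?conjc0; congr lt3; ring: aa bb cc.
Qed.

(* The partner of an eigenvalue is its class under the involution induced by
   [g -> g^-1] (first case) or [g -> - g^-1] (second case). *)
Definition partner (eps : bool) p q := if eps then p^* * q = 1 else p * q = -1.

Lemma partner_norm eps p q : partner eps p q -> `|p| * `|q| = 1.
Proof.
by case: eps => /(congr1 Num.norm); rewrite normrM ?normcJ ?normrN normr1.
Qed.

Lemma partner_sym eps p q : partner eps p q -> partner eps q p.
Proof.
case: eps => /= e; last by rewrite mulrC.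
by rewrite -[p]conjcK mulrC -rmorphM e /= conjc1.
Qed.

(** Partners have inverse norms, so the product forces [s] to have norm 1, whereas neither [p] nor
    [q] has norm 1. *)
Lemma third_eigenvalue eps p q s : `|p| != 1 -> partner eps p q ->
  `|p| * `|q| * `|s| = 1 ->
  partner eps s p \/ partner eps s q \/ partner eps s s ->
  [/\ p != q, s != p, s != q & partner eps s s].
Proof.
move=> p1 pq; rewrite (partner_norm pq) mul1r => s1.
have pq1 := partner_norm pq.
have q1 : `|q| != 1 by apply: contraNneq p1 => q1; rewrite -pq1 q1 mulr1.
have sp : s != p by apply: contraNneq p1 => <-; rewrite s1.
have sq : s != q by apply: contraNneq q1 => <-; rewrite s1.
have npq : p != q.
  apply: contraNneq p1 => pq'; move: pq1; rewrite -pq' -expr2 => /eqP.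
  by rewrite sqrp_eq1.
case=> [/partner_norm|[/partner_norm|//]]; rewrite s1 mul1r => /eqP.
  by rewrite (negPf p1).
by rewrite (negPf q1).
Qed.

Lemma ord3_third (i j : 'I_3) : i != j -> exists k, uniq [:: i; j; k].
Proof.
by case: i j => [[|[|[|i]]] // hi] [[|[|[|j]]] // hj] // _;
  (by exists 0) || (by exists 1) || (by exists 2).
Qed.

Lemma ord3_cases (i j k l : 'I_3) : uniq [:: i; j; k] ->
  [\/ l = i, l = j | l = k].
Proof.
case: i j k l => [[|[|[|i]]] // hi] [[|[|[|j]]] // hj] [[|[|[|k]]] // hk]
  [[|[|[|l]]] // hl] //= _;
  (by apply: Or31; apply: val_inj) || (by apply: Or32; apply: val_inj) ||
  (by apply: Or33; apply: val_inj).
Qed.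

Lemma reversed_swap eps (d : 'rV[C]_3) (i j k : 'I_3) :
  uniq [:: i; j; k] -> partner eps (d 0 i) (d 0 j) ->
  partner eps (d 0 k) (d 0 k) -> reversed_by_involution (liftC (diag_mx d)).
Proof.
move=> ijk dij dk; have dp l : partner eps (d 0 l) (d 0 (tperm i j l)).
  have [->|->|->] := ord3_cases l ijk; rewrite ?tpermL ?tpermR //.
    exact: partner_sym.
  move: ijk; rewrite /= !inE negb_or andbT => /andP[/andP[_ ik] jk].
  by rewrite tpermD.
apply: (@reversed_diag _ _ d (tperm i j)); first exact: tperm2.
by case: eps dp {dij dk} => dp; [left|right].
Qed.

Lemma jordan_reversed eps u a b c x y z : jordan_entries u a b c x y z ->
  u a = a -> u b = b -> `|a| * `|b| * `|c| = 1 ->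
  {in [:: a; b; c], forall p,
    exists2 q, q \in [:: a; b; c] & partner eps p q} ->
  reversed_by_involution (liftC (lt3 a b c x y z)).
Proof.
move=> J ua ub abc closed.
pose d : 'rV[C]_3 := \row_l nth 0 [:: a; b; c] l.
have dE l : d 0 l \in [:: a; b; c] by rewrite mxE mem_nth.
have Ed q : q \in [:: a; b; c] -> exists l, q = d 0 l.
  rewrite !inE => /or3P[] /eqP ->; [exists 0|exists 1|exists 2]; by rewrite mxE.
have dprod : \prod_l `|d 0 l| = 1.
  by rewrite !big_ord_recl big_ord0 !mxE /= mulr1 mulrA.
have [/forallP norm1|] := boolP [forall l, `|d 0 l| == 1].
  have aa := eqP (norm1 0); have bb := eqP (norm1 1); have cc := eqP (norm1 2).
  rewrite mxE /= in aa; rewrite mxE /= in bb; rewrite mxE /= in cc.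
  by apply: (jordan_unimodular J) => //; apply/normC_eq1.
rewrite negb_forall => /existsP[i di].
have [_ /Ed[j ->] dij] := closed _ (dE i).
have ij : i != j.
  apply: contraNneq di => ij; have := partner_norm dij.
  by rewrite -ij -expr2 => /eqP; rewrite sqrp_eq1.
have [k ijk] := ord3_third ij.
have dijk : `|d 0 i| * `|d 0 j| * `|d 0 k| = 1.
  have := ijk; rewrite /= !inE negb_or andbT => /andP[/andP[_ ik] jk].
  rewrite -dprod (bigD1 i) //= (bigD1 j) 1?eq_sym //= (bigD1 k) /=; last first.
    by rewrite ![k == _]eq_sym ik jk.
  rewrite big1 ?mulr1 ?mulrA // => l /andP[/andP[/negP li /negP lj] /negP lk].
  by have [] := ord3_cases l ijk; move=> lE; rewrite lE eqxx in li lj lk.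
have [|npq nsp nsq dk] := third_eigenvalue di dij dijk.
  have [_ /Ed[l ->] dkl] := closed _ (dE k).
  by have [lE|lE|lE] := ord3_cases l ijk; rewrite lE in dkl; tauto.
have dinj : injective (d 0).
  move=> l m; have [->|->|->] := ord3_cases l ijk;
  have [->|->|->] := ord3_cases m ijk => // /eqP;
  by rewrite ?(negPf npq, negPf nsp, negPf nsq) // eq_sym
    ?(negPf npq, negPf nsp, negPf nsq).
have ab : b != a by have := inj_eq dinj 1 0; rewrite !mxE /= => ->.
have ac : c != a by have := inj_eq dinj 2 0; rewrite !mxE /= => ->.
have bc : c != b by have := inj_eq dinj 2 1; rewrite !mxE /= => ->.
(* Every pattern but the diagonal one repeats an eigenvalue. *)
have -> : lt3 a b c x y z = diag_mx d.
  case: J => [[-> -> ->]|[/eqP]|[/eqP]|[[/eqP]|[[/eqP]]]];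
    rewrite ?(negPf ab, negPf ac, negPf bc) //.
  by apply/matrixP; case=> [[|[|[|m]]] // hm] [[|[|[|l]]] // hl]; rewrite !mxE.
exact: reversed_swap ijk dij dk.
Qed.

Lemma reversible_reversed eps (g h k : 'M[H]_3) : detH g = 1 -> h *m k = 1%:M ->
  g *m h *m g = (if eps then h else - h) -> reversed_by_involution g.
Proof.
move=> dg hk ghg.
(* [u] is the identity on the eigenvalues, but these are known to be nonzero
   only once the determinant of the Jordan form is computed. *)
pose u a : C := if a == 0 then 1 else a.
have u0 a : u a != 0 by rewrite /u; case: ifP => [_|->] //; apply: oner_neq0.
have [a [b [c [x [y [z [gM [ua ub uc] J]]]]]]] := quat_jordan3 u0 g.
apply: (reversed_sim gM); rewrite -/(liftC _); set M := lt3 a b c x y z in gM *.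
have [P [Q [PQ QP e]]] := gM.
have dM : detH (liftC M) = 1.
  have dP : detH P != 0.
    apply: contra_eq_neq (congr1 (@detH _ _) PQ) => dP0.
    by rewrite detHM detH1 dP0 mul0r eq_sym oner_neq0.
  have := congr1 (@detH _ _) e; rewrite !detHM dg mulr1 -/(liftC M).
  by rewrite -{1}[detH P]mul1r => /(mulIf dP).
have abc : `|a| * `|b| * `|c| = 1.
  move: dM; rewrite detH_liftC det_lt3 -sqr_normc !normrM => /eqP.
  by rewrite sqrp_eq1 ?mulr_ge0 // => /eqP.
have nz p : p \in [:: a; b; c] -> p != 0.
  rewrite !inE => pabc; apply: contra_eq_neq abc => p0.
  by case/or3P: pabc => /eqP pE;
    rewrite -pE p0 normr0 ?(mulr0, mul0r) eq_sym oner_neq0.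
have uE p : p \in [:: a; b; c] -> u p = p.
  by move/nz=> p0; rewrite /u (negPf p0).
have up p : p \in [:: a; b; c] -> upper p.
  by rewrite !inE => /or3P[] /eqP->.
apply: (jordan_reversed (eps := eps) J);
  rewrite ?uE ?inE ?eqxx ?orbT // => p pabc.
pose h1 := P *m h *m Q.
have Mh : liftC M *m h1 *m liftC M = if eps then h1 else - h1.
  have ME : liftC M = P *m g *m Q by rewrite e -mulmxA PQ mulmx1.
  have -> : liftC M *m h1 *m liftC M = P *m (g *m h *m g) *m Q.
    rewrite ME /h1 !mulmxA -(mulmxA _ Q P) QP mulmx1.
    by rewrite -(mulmxA _ Q P) QP mulmx1.
  by rewrite ghg /h1; case: (eps) => //; rewrite mulmxN mulNmx.
have h1k : h1 *m (P *m k *m Q) = 1%:M.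
  by rewrite /h1 !mulmxA -(mulmxA _ Q P) QP mulmx1 -(mulmxA P) hk mulmx1.
move: h1 (P *m k *m Q) Mh h1k => h1 k1 Mh h1k.
have [v v0 vM] := jordan_eigenvector J pabc.
(* Applying [M h1 M = h1] or [- h1] to the eigenvector [v] gives [p (v h1) M = v h1] or [- v h1], so
   [v h1] has eigenvalue [p^-1] or [- p^-1]. *)
pose w := map_mx (@quatC R) v *m h1.
have wM : w *m liftC M = quatC (if eps then p^-1 else - p^-1) *: w.
  have vM' : map_mx (@quatC R) v *m liftC M = quatC p *: map_mx (@quatC R) v.
    by rewrite -map_mxM vM map_mxZ.
  have := congr1 (mulmx (map_mx (@quatC R) v)) Mh.
  rewrite !mulmxA vM' -!scalemxAl -/w.
  move/(congr1 (fun t => quatC p^-1 *: t)); rewrite scalerA -rmorphM /=.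
  rewrite mulVf ?nz // scale1r => ->; case: (eps) => //.
  by rewrite mulmxN -/w scalerN rmorphN scaleNr.
have w0 : w != 0.
  apply: contraNneq v0 => /(congr1 (mulmxr k1)) /=.
  rewrite -mulmxA h1k mulmx1 mul0mx => /matrixP v0; apply/eqP/matrixP => s t.
  by have := v0 s t; rewrite !mxE => -[].
have [q qabc qE] := lt3_quat_eigenvalue w0 wM.
exists q => //; have := up _ qabc; have := up _ pabc; have := nz _ pabc.
move: qE; rewrite /partner; case: (eps) => [] qE p0 upp uq.
  have -> : q = (p^*)^-1.
    apply: upper_inj (upper_Vconj upp) _ => //.
    rewrite [(_^-1)^*]conjc_inv conjcK -conjc_inv.
    by case: qE => ->; [right|left; rewrite conjcK].
  by rewrite mulfV // conjc_eq0.
have <- : - p^-1 = q; last by rewrite mulrN mulfV.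
exact: upper_inj (upper_NV upp) uq qE.
Qed.

End Reversibility.

(** * Passage to the projective group *)

Lemma conjg_invE (G : groupType) (x y : G) :
  (y * x * y^-1 = x^-1)%g <-> (x * y * x = y)%g.
Proof.
split=> e; first by rewrite -{1}[x]invgK -e !invgM invgK mulgA !mulgVK.
by apply: (mulIg y); rewrite mulgVK; apply: (mulgI x); rewrite mulgA e mulVKg.
Qed.

Theorem theorem1p1 (R : realType) (g : PSL 3 R) :
  reversible g <-> strongly_reversible g.
Proof.
split=> [|[h _ hgh]]; last by exists h.
elim/quotW: g => g [h /conjg_invE]; elim/quotW: h => h ghg.
have {}ghg : \pi_(PSL 3 R) (mulSL (mulSL g h) g) = \pi_(PSL 3 R) h.
  by rewrite -!pi_mulPSL.
have hV : slval h *m slval (invSL h) = 1%:M by have [] := mulSLV h.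
have [k [dk kk gkg]] : reversed_by_involution (slval g).
  (* Equality of classes means equality of lifts up to sign; this sign is the flag [eps]. *)
  move/eqmodP: ghg => /= /orP[] /eqP /(congr1 (@slval _ _)) /= ghg.
    exact: (@reversible_reversed _ true _ _ _ (eqP (slvalP g)) hV).
  exact: (@reversible_reversed _ false _ _ _ (eqP (slvalP g)) hV).
have dk' : detH k == 1 by rewrite dk.
pose K := MkSL dk'; exists (\pi_(PSL 3 R) K).
  rewrite expg2.
  change (mulPSL (\pi_(PSL 3 R) K) (\pi_(PSL 3 R) K) = onePSL 3 R).
  rewrite pi_mulPSL; apply/eqmodP/orP.
  by case: kk => kk; [left|right]; apply/eqP/val_inj.
apply/conjg_invE.
change (mulPSL (mulPSL (\pi_(PSL 3 R) g) (\pi_(PSL 3 R) K)) (\pi_(PSL 3 R) g)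
  = \pi_(PSL 3 R) K).
rewrite !pi_mulPSL; apply/eqmodP/orP.
by case: gkg => gkg; [left|right]; apply/eqP/val_inj.
Qed.
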